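(* Let $T=0.21$, let $w\ge T$ be the unique solution of $I_w(T)=\sqrt{T/2}$, let $\varphi(t)=\min\{t,1-t\}/2$ for $t\in[0,1]$ (so $\varphi(t)=t/2$ on $[0,1/2]$), and define $\chi:[0,1/2]\to[0,\infty)$ by $$\chi(a)=\begin{cases} I_w(a)^2, & a\in[0,T],\\ a/2, & a\in(T,1/2].\end{cases}$$ Then for all $a_0,a_1\in\left[0,T+\sqrt{T/6}\right]$ with $\frac{a_0+a_1}{2}\le T$, $$\min\left\{\frac14\left(\sqrt{\chi(a_0)}+\sqrt{\chi(a_1)}\right)^2+\frac14(a_1-a_0)^2,\ \varphi\left(\frac{a_0+a_1}{2}\right)\right\}-\chi\left(\frac{a_0+a_1}{2}\right)\le 0 .$$ As a consequence, for every dyadic rational $a\in[0,1/2]$, $$W(a)\le\chi(a).$$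
   Context: For $f:\{\pm1\}^n\to\{0,1\}$ and $i\in\{1,\dots,n\}$, let $\hat f_i=\mathbb{E}[f(\mathbf X)X_i]$ with $\mathbf X$ uniform on $\{\pm1\}^n$, and let $\mathbf W_1[f]=\sum_{i=1}^n\hat f_i^2$ be the level-1 Fourier weight. For $a\in\{0,2^{-n},2\cdot2^{-n},\dots,1\}$, $W^{(n)}(a)$ is the maximum of $\mathbf W_1[f]$ over all $f:\{\pm1\}^n\to\{0,1\}$ with $\mathbb{E}f(\mathbf X)=a$. For a dyadic rational $a\in[0,1]$, $W(a)=\sup W^{(n)}(a)$, the supremum being over all $n\ge1$ with $2^na\in\mathbb{Z}$. Let $\phi$ and $\Phi$ be the standard Gaussian density and cumulative distribution function, and $I(t)=\phi(\Phi^{-1}(t))$ for $t\in(0,1)$, $I(0)=I(1)=0$ (the Gaussian isoperimetric profile). For $w>0$ and $0\le a\le w$, $I_w(a)=w\,I(a/w)$. *)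

(* Defs.v *)
From HB Require Import structures.
From mathcomp Require Import all_boot all_order all_algebra.
From mathcomp Require Import all_classical all_reals all_analysis.

Set Implicit Arguments.
Unset Strict Implicit.
Unset Printing Implicit Defensive.

Import Order.TTheory GRing.Theory Num.Theory.
Import numFieldNormedType.Exports.

Local Open Scope classical_set_scope.
Local Open Scope ring_scope.

(* {±1}^n, with a sign stored as the bit b such that the sign is (-1)^b. *)
Definition cube (n : nat) := {ffun 'I_n -> bool}.

Definition coord (R : realType) (n : nat) (x : cube n) (i : 'I_n) : R :=
  (-1) ^+ x i.

Definition mean (R : realType) (n : nat) (g : cube n -> R) : R :=
  (\sum_(x : cube n) g x) / 2 ^+ n.

Definition fourier1 (R : realType) (n : nat) (f : {ffun cube n -> bool})
    (i : 'I_n) : R :=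
  mean (fun x => (f x)%:R * coord R x i).

Definition weight1 (R : realType) (n : nat) (f : {ffun cube n -> bool}) : R :=
  \sum_(i < n) fourier1 R f i ^+ 2.

(* The maximum is over a nonempty set, and the default value 0 is harmless
   because the weights are nonnegative, as soon as a is in
   {0, 2^-n, ..., 1}; this is the only case that Wsup below uses. *)
Definition Wmax (R : realType) (n : nat) (a : R) : R :=
  \big[Num.max/0]_(f : {ffun cube n -> bool} |
                   mean (fun x => (f x)%:R) == a) weight1 R f.

(* An extended real, so that the supremum needs no boundedness proof. *)
Definition Wsup (R : realType) (a : R) : \bar R :=
  ereal_sup [set (Wmax n a)%:E | n in
              [set n : nat | (0 < n)%N /\ 2 ^+ n * a \is a Num.int]].

Definition dyadic (R : realType) (a : R) : Prop :=
  exists (m : int) (n : nat), a = m%:~R / 2 ^+ n.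

Definition gauss_pdf (R : realType) (x : R) : R := normal_pdf 0 1 x.

Definition gauss_cdf (R : realType) (x : R) : R :=
  fine (normal_prob 0 1 `]-oo, x]).

Definition gauss_quantile (R : realType) : R -> R :=
  pinv [set: R] (@gauss_cdf R).

Definition gauss_iso (R : realType) (t : R) : R :=
  if 0 < t < 1 then gauss_pdf (gauss_quantile t) else 0.

Definition gauss_iso_scaled (R : realType) (w a : R) : R :=
  w * gauss_iso (a / w).

Definition threshold (R : realType) : R := 21 / 100.

Definition varphi (R : realType) (t : R) : R := Num.min t (1 - t) / 2.

Definition chi (R : realType) (w a : R) : R :=
  if a <= threshold R then gauss_iso_scaled w a ^+ 2 else a / 2.

(* Main.v *)
Require Import Defs.
From HB Require Import structures.
From mathcomp Require Import all_boot all_order all_algebra.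
From mathcomp Require Import all_classical all_reals all_analysis.
From mathcomp Require Import ring lra.

(* The scaled profile f = I_w satisfies f f'' = -1 and f' = - Phi^-1 (./w),
   which is convex where it is nonnegative.  For a fixed midpoint a, the
   h-derivative of ((f(a+h) + f(a-h)) / 2)^2 + h^2 is nonpositive by a trapezoid
   inequality for the Gaussian density, which holds as soon as the mean of the
   slopes at a+h and a-h is at least 1; by convexity f'(a) >= 1 suffices.  The
   condition f'(T) >= 1 says Phi^-1(T/w) <= -1, and reduces to a numerical lower
   bound on Mills' ratio at 1.  To the right of T, sqrt(a/2) <= f(a) up to
   T + sqrt(T/6), so the inequality for f gives the one for chi, and the term
   varphi of the minimum is never needed.

   For the weights, W_1[f] <= E f / 2 settles means above T and dimensions at
   most 2.  Otherwise, split along the coordinate with the smallest level-1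
   coefficient: its square is at most (T/2)/3, which keeps both means below
   T + sqrt(T/6), and Minkowski's inequality matches the two-point inequality. *)

Set Implicit Arguments.
Unset Strict Implicit.
Unset Printing Implicit Defensive.

Import Order.TTheory GRing.Theory Num.Theory.
Import numFieldNormedType.Exports.

Local Open Scope classical_set_scope.
Local Open Scope ring_scope.

(** * Monotonicity from the sign of a derivative *)

Section monotonicity.
Context {R : realType}.
Implicit Types (f df : R -> R) (a b : R).

Lemma derive_continuous f (df : R) (x : R) :
  is_derive x 1 f df -> {for x, continuous f}.
Proof. by case=> d _; apply: differentiable_continuous; exact/derivable1_diffP. Qed.

Lemma derive_ge0_le f df a b : a <= b ->
  (forall x, a <= x <= b -> is_derive x 1 f (df x)) ->
  (forall x, a < x < b -> 0 <= df x) -> f a <= f b.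
Proof.
rewrite le_eqVlt => /predU1P[-> //|ab] fd d0.
have [| |c] := @MVT _ f df a b ab.
- by move=> x; rewrite in_itv/= => /andP[ax xb]; apply: fd; rewrite !ltW.
- by apply: derivable_within_continuous => x; rewrite in_itv/= => /fd[].
by rewrite in_itv/= => cab e; rewrite -subr_ge0 e mulr_ge0 ?d0// subr_ge0 ltW.
Qed.

Lemma derive_gt0_lt f df a b : a < b ->
  (forall x, a <= x <= b -> is_derive x 1 f (df x)) ->
  (forall x, a < x < b -> 0 < df x) -> f a < f b.
Proof.
move=> ab fd d0.
have [| |c] := @MVT _ f df a b ab.
- by move=> x; rewrite in_itv/= => /andP[ax xb]; apply: fd; rewrite !ltW.
- by apply: derivable_within_continuous => x; rewrite in_itv/= => /fd[].
by rewrite in_itv/= => cab e; rewrite -subr_gt0 e mulr_gt0 ?d0// subr_gt0.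
Qed.

End monotonicity.

(** * Gaussian density and distribution function; bounds on Mills' ratio *)

Section gaussian.
Context {R : realType}.
Local Notation phi := (@gauss_pdf R).
Local Notation Phi := (@gauss_cdf R).
Local Notation q := (@gauss_quantile R).
Local Notation I := (@gauss_iso R).

Lemma gauss_pdfE x : phi x = normal_peak 1 * expR (- (x ^+ 2 / 2)).
Proof.
by rewrite /gauss_pdf normal_pdfE ?oner_neq0// /normal_fun subr0 expr1n mulNr.
Qed.

Lemma gauss_pdf_gt0 x : 0 < phi x.
Proof. by rewrite gauss_pdfE mulr_gt0 ?expR_gt0// normal_peak_gt0 ?oner_neq0. Qed.

Lemma gauss_pdfN x : phi (- x) = phi x.
Proof. by rewrite !gauss_pdfE sqrrN. Qed.

Lemma is_derive_gauss_pdf (x : R) : is_derive x 1 phi (- x * phi x).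
Proof.
have -> : phi = (fun x => normal_peak 1 * expR (- (x ^+ 2 / 2))).
  by apply/funext => y; rewrite gauss_pdfE.
apply: trigger_derive; rewrite /GRing.scale/=.
by field.
Qed.

Lemma is_derive_gauss_cdf (x : R) : is_derive x 1 Phi (phi x).
Proof.
(* The right end only has to lie beyond [x]: the fundamental theorem of calculus needs an interval
   containing [x] in its interior. *)
have xu : x < x + 1 by rewrite ltrDl.
have [| | |d e] := @continuous_FTC1 R phi (BInfty _ true) x (x + 1) xu.
- apply: integrableS (@integrable_normal_pdf R 0 1) => //.
- by rewrite ltNyr.
- exact: (@continuous_normal_pdf R 0 1 (oner_neq0 _)).

by apply: DeriveDef => //; rewrite -derive1E.
Qed.

Lemma gauss_cdf_lt x y : x < y -> Phi x < Phi y.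
Proof.
move=> xy; apply: (derive_gt0_lt (df:=phi)) => // z _ ; last exact: gauss_pdf_gt0.
exact: is_derive_gauss_cdf.
Qed.

Lemma gauss_cdf_le x y : (Phi x <= Phi y) = (x <= y).
Proof. exact: (le_mono gauss_cdf_lt). Qed.

(** As a random variable under the Gaussian law, the identity has distribution function [gauss_cdf],
    so general limits of distribution functions apply. *)
Let X : measurableTypeR R -> R := idfun.

HB.instance Definition _ :=
  @isMeasurableFun.Build _ _ _ _ X (@measurable_id _ _ setT).

Lemma gauss_cdf_cvgNy : Phi x @[x --> -oo] --> (0 : R).
Proof.
have := @cvg_cdfNy0 _ _ R (normal_prob 0 1) (X : {RV _ >-> _}).
by move/fine_cvgP => [_].
Qed.

Lemma gauss_cdf_cvgy : Phi x @[x --> +oo] --> (1 : R).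
Proof.
have := @cvg_cdfy1 _ _ R (normal_prob 0 1) (X : {RV _ >-> _}).
by move/fine_cvgP => [_].
Qed.

Lemma gauss_pdf_cvgy : phi x @[x --> +oo] --> (0 : R).
Proof.
have -> : phi = (fun x => normal_peak 1 * expR (- (x ^+ 2 / 2))).
  by apply/funext => y; rewrite gauss_pdfE.
rewrite -[X in _ --> X](mulr0 (normal_peak 1)); apply: cvgM; first exact: cvg_cst.
apply: (cvg_comp (fun x : R => x ^+ 2 / 2) (fun x => expR (- x))).
  by apply: gt0_cvgMly; [rewrite invr_gt0|exact: cvgr_expr2].
exact: cvgr_expR.
Qed.

(** The difference [D] of the two sides has derivative [phi y * (c - y * r y + dr y)], so it
    increases strictly, and it tends to 0 at infinity; hence it is negative at [b]. The sign of [c]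
    decides whether Mills' ratio is bounded from above or from below. *)
Lemma gauss_cdfN_gt (c : R) (r dr : R -> R) (b M : R) :
  (forall y, b <= y -> is_derive y 1 r (dr y)) ->
  (forall y, b <= y -> `|r y| <= M) ->
  (forall y, b <= y -> 0 < c - y * r y + dr y) ->
  phi b * r b < c * Phi (- b).
Proof.
move=> rd rM dr0; pose D y := phi y * r y - c * Phi (- y).
have Dd y : b <= y -> is_derive y 1 D (phi y * (c - y * r y + dr y)).
  move=> yb; have := rd _ yb => ?.
  have ? := is_derive_gauss_pdf y.
  have ? : is_derive y 1 (fun z => Phi (- z)) (- phi y).
    rewrite -gauss_pdfN -mulrN1; apply: (@is_derive1_comp _ Phi -%R).
    exact: is_derive_gauss_cdf.
  apply: trigger_derive; rewrite /GRing.scale/=.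
  by ring.
have Dlt x y : b <= x -> x < y -> D x < D y.
  move=> bx xy; apply: derive_gt0_lt xy _ _ => z /andP[xz _].
    by apply: Dd; exact: le_trans xz.
  by rewrite mulr_gt0 ?gauss_pdf_gt0 ?dr0//; rewrite (le_trans bx)// ltW.
have D0 : D x @[x --> +oo] --> (0 : R).
  rewrite -[X in _ --> X](subr0 0) -[X in _ --> _ - X](mulr0 c).
  apply: cvgB; last first.
    apply: cvgM; first exact: cvg_cst.
    apply: (cvg_comp (@GRing.opp R) Phi) gauss_cdf_cvgNy.
    by apply/cvgNrNy; exact: cvg_id.
  apply: norm_cvg0.
  have M0 : phi x * M @[x --> +oo] --> (0 : R).
    by rewrite -[X in _ --> X](mul0r M); apply: cvgM;
      [exact: gauss_pdf_cvgy|exact: cvg_cst].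
  apply: squeeze_cvgr (cvg_cst 0) M0; near=> x.
  rewrite normr_ge0 normrM ger0_norm ?(ltW (gauss_pdf_gt0 _))//=.
  by rewrite ler_wpM2l ?(ltW (gauss_pdf_gt0 _))// rM.
(* The limit only gives a weak inequality; passing through [b + 1] makes it strict. *)
rewrite -subr_lt0 -/(D b) (@lt_le_trans _ _ (D (b + 1)))//.
  by apply: Dlt => //; rewrite ltrDl.
apply: (cvgr_to_ge D0); near=> x.
apply/ltW/Dlt; first by rewrite lerDl.
by near: x; apply: nbhs_pinfty_gt; rewrite num_real.
Unshelve. all: by end_near. Qed.

Lemma gauss_cdfN_lt (b : R) : 0 < b -> b * Phi (- b) < phi b.
Proof.
move=> b0.
have := @gauss_cdfN_gt (-1) (fun y => - y^-1) (fun y => y ^- 2) b b^-1.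
rewrite mulrN mulN1r ltrN2 -ltr_pdivlMl// mulrC; apply.
- move=> y yb; have y0 : y != 0 by rewrite gt_eqF// (lt_le_trans b0).
  have ? : is_derive y 1 (fun z => z^-1) _ := is_deriveV y0 (is_derive_id y 1).
  by apply: trigger_derive; rewrite /GRing.scale/=; field.
- move=> y yb; rewrite normrN ger0_norm ?lef_pV2 ?posrE ?invr_ge0//.
    by rewrite (lt_le_trans b0).
  by rewrite (le_trans (ltW b0)).
- move=> y yb; have y0 : 0 < y by rewrite (lt_le_trans b0).
  by rewrite mulrN divff ?gt_eqF// opprK addNr add0r invr_gt0 exprn_gt0.
Qed.

(* The rational function is fitted to Mills' ratio at 1: among
   (y + α) / (y^2 + α y + β), this choice satisfies the differential inequality
   for all y > 0 and is large enough at 1. *)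
Lemma gauss_cdfN1_gt : 28 / 43 * phi 1 < Phi (- 1).
Proof.
pose p (y : R) := y ^+ 2 + 4 / 3 * y + 5 / 4.
have p0 y : 1 <= y -> 0 < p y by rewrite /p; nra.
have := @gauss_cdfN_gt 1 (fun y => (y + 4 / 3) / p y)
  (fun y => (p y - (y + 4 / 3) * (2 * y + 4 / 3)) / p y ^+ 2) 1 1.
rewrite mul1r => h.
have -> : 28 / 43 * phi 1 = phi 1 * ((1 + 4 / 3) / p 1) by rewrite /p; field.
apply: h => y y1; have := p0 _ y1 => py0.
- have pn0 : p y != 0 by rewrite gt_eqF.
  have pd : is_derive y 1 p (2 * y + 4 / 3).
    by apply: trigger_derive; rewrite /GRing.scale/=; field.
  have ? : is_derive y 1 (fun z => (p z)^-1) _ := is_deriveV pn0 pd.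
  by apply: trigger_derive; rewrite /GRing.scale/=; field.
- rewrite ger0_norm ?divr_ge0 ?(ltW py0)//; last lra.
  by rewrite ler_pdivrMr// mul1r /p; nra.
(* The numerator is [(y / 2 - 1) ^+ 2 + 5 / 144]. *)
- rewrite [ltRHS](_ : _ = (y ^+ 2 / 4 - y + 149 / 144) / p y ^+ 2).
    rewrite divr_gt0 ?exprn_gt0//.
    have : 0 <= (y / 2 - 1) ^+ 2 by rewrite sqr_ge0.
    lra.
  by rewrite /p; field; apply/eqP; nra.
Qed.
End gaussian.

(** * The quantile function and the derivatives of the isoperimetric profile *)

Section quantile.
Context {R : realType}.
Local Notation phi := (@gauss_pdf R).
Local Notation Phi := (@gauss_cdf R).
Local Notation q := (@gauss_quantile R).
Local Notation I := (@gauss_iso R).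

Lemma gauss_cdf_continuous : continuous Phi.
Proof. by move=> x; apply: derive_continuous; exact: is_derive_gauss_cdf. Qed.

Lemma gauss_cdf_gt0 x : 0 < Phi x.
Proof.
rewrite (@le_lt_trans _ _ (Phi (x - 1)))//; last first.
  by rewrite gauss_cdf_lt// ltrBlDr ltrDl.
apply: (cvgr_to_le gauss_cdf_cvgNy); near=> y.
by rewrite gauss_cdf_le; near: y; apply: nbhs_ninfty_le; rewrite num_real.
Unshelve. all: by end_near. Qed.

Lemma gauss_cdf_lt1 x : Phi x < 1.
Proof.
rewrite (@lt_le_trans _ _ (Phi (x + 1)))//; first by rewrite gauss_cdf_lt// ltrDl.
apply: (cvgr_to_ge gauss_cdf_cvgy); near=> y.
by rewrite gauss_cdf_le; near: y; apply: nbhs_pinfty_ge; rewrite num_real.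
Unshelve. all: by end_near. Qed.

Lemma gauss_quantileK : cancel Phi q.
Proof.
have inj : {in [set: R] &, injective Phi}.
  by move=> y z _ _; exact: (inc_inj gauss_cdf_le).
by move=> x; apply: (pinvKV _ inj); rewrite in_setE.
Qed.

Lemma gauss_cdfK (t : R) : 0 < t < 1 -> Phi (q t) = t.
Proof.
move=> /andP[t0 t1].
suff [x <-] : exists x, Phi x = t by rewrite gauss_quantileK.
have [a at_] : exists a, Phi a < t.
  apply: (@filter_ex _ (nbhs (-oo : set_system R))).
  exact: (cvgr_lt _ gauss_cdf_cvgNy).
have [b tb] : exists b, t < Phi b.
  apply: (@filter_ex _ (nbhs (+oo : set_system R))).
  exact: (cvgr_gt _ gauss_cdf_cvgy).
have ab : a <= b by rewrite -gauss_cdf_le ltW// (lt_trans at_).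
have [||c _ <-] := @IVT R Phi a b t ab; last by exists c.
- by apply: continuous_subspaceT; exact: gauss_cdf_continuous.
- by rewrite ge_min le_max (ltW at_) (ltW tb) orbT.
Qed.

Lemma gauss_quantile_lt (s t : R) : 0 < s -> s < t -> t < 1 -> q s < q t.
Proof.
move=> s0 st t1; rewrite -(leW_mono gauss_cdf_le).
by rewrite !gauss_cdfK// ?s0 ?(lt_trans s0)// (lt_trans st).
Qed.

Lemma is_derive_gauss_quantile (t : R) : 0 < t < 1 -> is_derive t 1 q (phi (q t))^-1.
Proof.
move=> t01; rewrite -{1}(gauss_cdfK t01).
apply: is_derive_inverse.
- by near=> x; exact: gauss_quantileK.
- by near=> x; exact: gauss_cdf_continuous.
- exact: is_derive_gauss_cdf.
- by rewrite gt_eqF// gauss_pdf_gt0.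
Unshelve. all: by end_near. Qed.

Lemma gauss_isoE (t : R) : 0 < t < 1 -> I t = phi (q t).
Proof. by rewrite /gauss_iso => ->. Qed.

Lemma gauss_iso_gt0 (t : R) : 0 < t < 1 -> 0 < I t.
Proof. by move=> ?; rewrite gauss_isoE// gauss_pdf_gt0. Qed.

Lemma gauss_iso_ge0 (t : R) : 0 <= I t.
Proof. by rewrite /gauss_iso; case: ifP => // _; exact/ltW/gauss_pdf_gt0. Qed.

Lemma is_derive_gauss_iso (t : R) : 0 < t < 1 -> is_derive t 1 I (- q t).
Proof.
move=> t01; have d : is_derive t 1 (phi \o q) (- q t).
  rewrite -[X in is_derive _ _ _ X](mulfK (lt0r_neq0 (gauss_pdf_gt0 (q t)))).
  apply: is_derive1_comp; first exact: is_derive_gauss_pdf.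
  exact: is_derive_gauss_quantile.
(* [I] is defined by cases and is only compared with [phi \o q] on a neighbourhood of [t] inside the
   unit interval. *)
apply: near_eq_is_derive d.
move/andP: t01 => [t0 t1]; near=> z; rewrite gauss_isoE//=.
by apply/andP; split; near: z; [exact: lt_nbhsr|exact: lt_nbhsl].
Unshelve. all: by end_near. Qed.

Lemma is_derive_gauss_slope (t : R) : 0 < t < 1 ->
  is_derive t 1 (fun s => - q s) (- (I t)^-1).
Proof.
move=> t01; have ? := is_derive_gauss_quantile t01.
by apply: trigger_derive; rewrite gauss_isoE.
Qed.

End quantile.

(** * The two-point inequality for the unscaled profile *)

Section two_point.
Context {R : realType}.
Local Notation phi := (@gauss_pdf R).
Local Notation Phi := (@gauss_cdf R).
Local Notation q := (@gauss_quantile R).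
Local Notation I := (@gauss_iso R).

Lemma gauss_pdf_le (x y : R) : x <= y -> y <= 0 -> phi x <= phi y.
Proof.
move=> xy y0; rewrite !gauss_pdfE ler_wpM2l ?normal_peak_ge0// ler_expR; nra.
Qed.

Lemma expR_subN_ge (u : R) : 0 <= u -> 2 * u <= expR u - expR (- u).
Proof.
move=> u0.
pose f (x : R) := expR x - expR (- x) - 2 * x.
suff : f 0 <= f u by rewrite /f oppr0 subrr mulr0 subr0 subr_ge0.
apply: (derive_ge0_le (df := fun x => expR x + expR (- x) - 2)) => // x _.
  by apply: trigger_derive; rewrite /GRing.scale/=; ring.
have e : expR x * expR (- x) = 1 by rewrite -expRD subrr expR0.
have -> : expR x + expR (- x) - 2 = (expR x - 1) ^+ 2 * expR (- x).
  transitivity (expR x * (expR x * expR (- x))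
      - 2 * (expR x * expR (- x)) + expR (- x)).
    by rewrite e; ring.
  by ring.
by rewrite mulr_ge0 ?sqr_ge0 ?expR_ge0.
Qed.

(** With [g] the geometric mean of the two densities, they are [g * expR u] and [g * expR (- u)].
    The claim becomes [p - r <= 2 sinh u], and [2 * u = (p - r) * (p + r) / 2] is at least
    [p - r]. *)
Lemma gauss_pdf_sqr_sub (p r : R) : r <= p -> 2 <= p + r ->
  phi r * phi p * (p - r) ^+ 2 <= (phi r - phi p) ^+ 2.
Proof.
move=> rp pr2; pose u := (p ^+ 2 - r ^+ 2) / 4.
pose g := normal_peak 1 * expR (- ((p ^+ 2 + r ^+ 2) / 4)).
have pr : phi r = g * expR u.
  by rewrite gauss_pdfE /g -mulrA -expRD; congr (_ * expR _); rewrite /u; field.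
have pp : phi p = g * expR (- u).
  by rewrite gauss_pdfE /g -mulrA -expRD; congr (_ * expR _); rewrite /u; field.
have ee : expR u * expR (- u) = 1 by rewrite -expRD subrr expR0.
rewrite pr pp -mulrBr exprMn [g * _ * _]mulrACA ee mulr1 -expr2 ler_wpM2l ?sqr_ge0//.
have u0 : p - r <= 2 * u by rewrite /u; nra.
rewrite ler_sqr ?nnegrE ?subr_ge0//.
  rewrite (le_trans u0)// expR_subN_ge// -(@pmulr_rge0 _ 2)//.
  by rewrite (le_trans _ u0)// subr_ge0.
by rewrite ler_expR; lra.
Qed.

Lemma is_derive_addl (f : R -> R) (m t df : R) : is_derive (m + t) 1 f df ->
  is_derive t 1 (fun s => f (m + s)) df.
Proof.
move=> fd; rewrite -[df]mulr1; apply: (@is_derive1_comp _ f (+%R m)) => //.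
by apply: trigger_derive; rewrite add0r.
Qed.

Lemma is_derive_subl (f : R -> R) (m t df : R) : is_derive (m - t) 1 f df ->
  is_derive t 1 (fun s => f (m - s)) (- df).
Proof.
move=> fd; rewrite -[df]mulr1 -mulrN.
apply: (@is_derive1_comp _ f (fun s => m - s)) => //.
by apply: trigger_derive; rewrite add0r mul1r.
Qed.

Lemma gauss_quantile_le0 (t : R) : 0 < t -> t <= Phi 0 -> q t <= 0.
Proof.
move=> t0 t1; rewrite -gauss_cdf_le gauss_cdfK// t0/=.
exact: le_lt_trans (gauss_cdf_lt1 0).
Qed.

(** Strictness of [h < m] keeps both points where [I] is differentiable, and [m + h <= Phi 0] keeps
    both quantiles nonpositive, where [phi] increases. *)
Lemma gauss_two_point_lt (m h : R) :
  0 <= h -> h < m -> m + h <= Phi 0 -> q m <= - 1 ->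
  ((I (m + h) + I (m - h)) / 2) ^+ 2 + h ^+ 2 <= I m ^+ 2.
Proof.
move=> h0 hm mh qm; have Phi01 := gauss_cdf_lt1 (0 : R).
have mtop (t : R) : 0 <= t -> t <= h -> 0 < m + t < 1.
  by move=> t0 th; apply/andP; split; lra.
have mbot (t : R) : 0 <= t -> t <= h -> 0 < m - t < 1.
  by move=> t0 th; apply/andP; split; lra.
have dItop (t : R) (t0 : 0 <= t) (th : t <= h) :=
  is_derive_addl (is_derive_gauss_iso (mtop t t0 th)).
have dIbot (t : R) (t0 : 0 <= t) (th : t <= h) :=
  is_derive_subl (is_derive_gauss_iso (mbot t t0 th)).
have dqtop (t : R) (t0 : 0 <= t) (th : t <= h) :=
  is_derive_addl (is_derive_gauss_slope (mtop t t0 th)).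
have dqbot (t : R) (t0 : 0 <= t) (th : t <= h) :=
  is_derive_subl (is_derive_gauss_slope (mbot t t0 th)).
have qle (t : R) : 0 <= t -> t <= h -> q (m - t) <= q (m + t) <= 0.
  move=> t0 th; have /andP[t1 t2] := mtop t t0 th.
  have /andP[t3 t4] := mbot t t0 th; apply/andP; split.
    have [->|tn0] := eqVneq t 0; first by rewrite addr0 subr0.
    apply/ltW/gauss_quantile_lt => //.
    have : 0 < t by rewrite lt_neqAle eq_sym tn0.
    lra.
  by apply: gauss_quantile_le0; lra.
have Ile (t : R) : 0 <= t -> t <= h -> I (m - t) <= I (m + t).
  move=> t0 th; have /andP[? ?] := qle t t0 th.
  by rewrite !gauss_isoE ?mbot ?mtop//; exact: gauss_pdf_le.
(* The slope [- q] of [I] is convex where it is nonnegative, so its mean over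
   the two points is at least its value at the midpoint. *)
have slope (t : R) : 0 <= t -> t <= h -> 2 <= - q (m + t) - q (m - t).
  move=> t0 th; pose S (s : R) := - q (m + s) + - q (m - s).
  apply: (@le_trans _ _ (S 0)); first by rewrite /S addr0 subr0; lra.
  apply: (derive_ge0_le (df := fun s : R => (I (m - s))^-1 - (I (m + s))^-1)) => //.
    move=> s /andP[s0 st]; have sh : s <= h by exact: le_trans th.
    have ? := dqtop s s0 sh; have ? := dqbot s s0 sh.
    by apply: trigger_derive; ring.
  move=> s /andP[s0 st].
  have s0' := ltW s0; have sh : s <= h by exact/ltW/(lt_le_trans st).
  by rewrite subr_ge0 lef_pV2 ?Ile// posrE gauss_iso_gt0 ?mbot ?mtop.
(* [2 * t] is the integral of [phi] between the quantiles of [m - t] and [m + t]; the right side is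
   its trapezoid rule. Equality holds at 0, and the gap [K] is shown to grow with [t]. *)
have trapezoid (t : R) : 0 <= t -> t <= h ->
    2 * t <= (I (m + t) + I (m - t)) / 2 * (q (m + t) - q (m - t)).
  move=> t0 th.
  pose K (s : R) :=
    (I (m + s) + I (m - s)) / 2 * (- q (m - s) - - q (m + s)) - 2 * s.
  pose dK (s : R) := ((I (m + s) - I (m - s)) ^+ 2 / (I (m + s) * I (m - s))
    - (q (m + s) - q (m - s)) ^+ 2) / 2.
  suff : K 0 <= K t by rewrite /K addr0 subr0; lra.
  apply: (derive_ge0_le (df := dK)) => // s /andP[s0 st].
    have sh : s <= h by exact: le_trans th.
    have ? := dqtop s s0 sh; have ? := dqbot s s0 sh.
    have ? := dItop s s0 sh; have ? := dIbot s s0 sh.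
    have ? : I (m + s) != 0 by rewrite gt_eqF// gauss_iso_gt0 ?mtop.
    have ? : I (m - s) != 0 by rewrite gt_eqF// gauss_iso_gt0 ?mbot.
    by apply: trigger_derive; rewrite /dK /GRing.scale/=; field; apply/andP.
  have s0' := ltW s0; have sh : s <= h by exact/ltW/(lt_le_trans st).
  have i1 : 0 < I (m + s) by rewrite gauss_iso_gt0 ?mtop.
  have i2 : 0 < I (m - s) by rewrite gauss_iso_gt0 ?mbot.
  rewrite /dK divr_ge0// subr_ge0 ler_pdivlMr ?mulr_gt0//.
  have /andP[qm1 qm2] := qle s s0' sh; have sl := slope s s0' sh.
  (* The density inequality is applied to the reflected quantiles, which are nonnegative; [slope]
     provides its condition on their sum. *)
  have W : I (m + s) * I (m - s) * (- q (m - s) - - q (m + s)) ^+ 2 <=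
      (I (m + s) - I (m - s)) ^+ 2.
    rewrite !gauss_isoE ?mbot ?mtop// -[phi (q (m + s))]gauss_pdfN.
    rewrite -[phi (q (m - s))]gauss_pdfN.
    by apply: gauss_pdf_sqr_sub; rewrite ?lerN2//; lra.
  by apply: le_trans W; lra.
pose G (t : R) := - (((I (m + t) + I (m - t)) / 2) ^+ 2 + t ^+ 2).
pose dG (t : R) := (I (m + t) + I (m - t)) / 2 * (q (m + t) - q (m - t)) - 2 * t.
suff : G 0 <= G h by rewrite /G addr0 subr0; lra.
apply: (derive_ge0_le (df := dG)) => // s /andP[s0 sh].
  have ? := dItop s s0 sh; have ? := dIbot s s0 sh.
  by apply: trigger_derive; rewrite /dG /GRing.scale/=; field.
by rewrite subr_ge0 trapezoid ?ltW.
Qed.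

Lemma gauss_two_point (m h : R) :
  0 <= h -> 0 < m -> h <= m -> m + h <= Phi 0 -> q m <= - 1 ->
  ((I (m + h) + I (m - h)) / 2) ^+ 2 + h ^+ 2 <= I m ^+ 2.
Proof.
move=> h0 m0 hm mh qm.
have [hm'|mh'] := ltP h m; first exact: gauss_two_point_lt.
have e : h = m by apply/eqP; rewrite eq_le hm.
rewrite {}e in mh *.
have -> : I (m - m) = 0 by rewrite subrr /gauss_iso ltxx.
rewrite addr0.
(* At [h = m] the lower point is 0, where [I] is 0 by convention. The nonnegative [I (m - t)] is
   dropped before the limit, so continuity is only needed at [m + m]. *)
have cI : (I (m + t) / 2) ^+ 2 + t ^+ 2 @[t --> m^'-] -->
    (I (m + m) / 2) ^+ 2 + m ^+ 2.
  apply: cvg_at_left_filter.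
  apply: (@derive_continuous _ (fun t => (I (m + t) / 2) ^+ 2 + t ^+ 2)).
  have mm : 0 < m + m < 1.
    by rewrite addr_gt0//= (le_lt_trans mh)// gauss_cdf_lt1.
  have ? := is_derive_addl (is_derive_gauss_iso mm).
  by apply: trigger_derive.
apply: (cvgr_to_le cI); near=> t.
have tm : t < m by [].
have t0 : 0 < t by near: t; exact: nbhs_left_gt.
apply: (@le_trans _ _ (((I (m + t) + I (m - t)) / 2) ^+ 2 + t ^+ 2)).
  rewrite lerD2r ler_sqr ?nnegrE ?divr_ge0 ?addr_ge0 ?gauss_iso_ge0//.
  by rewrite ler_pM2r// lerDl gauss_iso_ge0.
by apply: gauss_two_point_lt => //; lra.
Unshelve. all: by end_near. Qed.

End two_point.

(** * Existence, uniqueness and location of the scale [w] *)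

Section profile.
Context {R : realType}.
Local Notation phi := (@gauss_pdf R).
Local Notation Phi := (@gauss_cdf R).
Local Notation q := (@gauss_quantile R).
Local Notation I := (@gauss_iso R).
Local Notation T := (threshold R).
Local Notation tau := (Num.sqrt (T / 2)).

(** This is strict decrease of [phi / Phi]. The sign of its derivative is that of
    [- (z * Phi z + phi z)], which for negative [z] is settled by the upper bound on Mills'
    ratio. *)
Lemma gauss_ratio_decr (x y : R) : x < y -> Phi x * phi y < Phi y * phi x.
Proof.
move=> xy; pose f (z : R) := - (phi z / Phi z).
suff : f x < f y.
  rewrite /f ltrN2 ltr_pdivrMr ?gauss_cdf_gt0// mulrAC.
  by rewrite ltr_pdivlMr ?gauss_cdf_gt0// mulrC [ltRHS]mulrC.
pose df (z : R) := phi z * (z * Phi z + phi z) / Phi z ^+ 2.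
apply: (derive_gt0_lt (df := df)) => // z _; rewrite /df.
  have P0 : Phi z != 0 by rewrite gt_eqF// gauss_cdf_gt0.
  have ? := is_derive_gauss_pdf z.
  have ? : is_derive z 1 (fun u => (Phi u)^-1) _ :=
    is_deriveV P0 (is_derive_gauss_cdf z).
  by apply: trigger_derive; rewrite /GRing.scale/=; field.
rewrite divr_gt0 ?exprn_gt0 ?mulr_gt0 ?gauss_pdf_gt0 ?gauss_cdf_gt0//.
have [z0|z0] := leP 0 z.
  by rewrite ltr_wpDl ?gauss_pdf_gt0// mulr_ge0// ltW// gauss_cdf_gt0.
have := @gauss_cdfN_lt R (- z); rewrite oppr_gt0 opprK gauss_pdfN => /(_ z0).
lra.
Qed.

(** The density is at least [phi 1] on the interval from -1 to 0, so [Phi] gains at least [phi 1]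
    there, and [phi 1] exceeds [Phi (- 1)]. *)
Lemma gauss_cdfN1_le : 2 * Phi (- 1) <= Phi 0.
Proof.
have : Phi (- 1) + phi 1 <= Phi 0.
  pose f (x : R) := Phi x - x * phi 1.
  suff : f (- 1) <= f 0 by rewrite /f; lra.
  apply: (derive_ge0_le (df := fun x => phi x - phi 1)).
  - lra.
  - move=> x _; have ? := is_derive_gauss_cdf x.
    by apply: trigger_derive; rewrite /GRing.scale/=; ring.
  - move=> x /andP[x1 x0]; rewrite subr_ge0 -gauss_pdfN gauss_pdf_le//; exact: ltW.
have := @gauss_cdfN_lt R 1; rewrite ltr01 => /(_ isT).
lra.
Qed.

(** A second-order Taylor bound: the slope at [s] is at least 1, and the second derivative [- 1 / I]
    is at least [- 1 / I s] because [I] increases up to [Phi 0]. *)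
Lemma gauss_iso_ge (s d : R) : 0 < s < 1 -> 0 <= d -> s + d <= Phi 0 ->
  q s <= - 1 -> I s + d - d ^+ 2 / (2 * I s) <= I (s + d).
Proof.
move=> /andP[s0 s1] d0 sd qs; have P01 := gauss_cdf_lt1 (0 : R).
have s01 t : 0 <= t -> t <= d -> 0 < s + t < 1 by move=> ? ?; apply/andP; split; lra.
have Is0 : 0 < I s by rewrite gauss_iso_gt0 ?s0.
have Ile t : 0 <= t -> t <= d -> I s <= I (s + t).
  move=> t0 td; rewrite !gauss_isoE ?s01 ?s0//; apply: gauss_pdf_le.
    rewrite le_eqVlt; have [->|t00] := eqVneq t 0; first by rewrite addr0 eqxx.
    rewrite gauss_quantile_lt ?orbT//; first by rewrite ltrDl lt_neqAle eq_sym t00.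
    by have /andP[] := s01 _ t0 td.
  by apply: gauss_quantile_le0; [have /andP[] := s01 _ t0 td|lra].
have slope t : 0 <= t -> t <= d -> 0 <= - q (s + t) - 1 + t / I s.
  move=> t0 td; pose f (u : R) := - q (s + u) + u * (I s)^-1.
  suff : f 0 <= f t by rewrite /f addr0; lra.
  apply: (derive_ge0_le (df := fun u => - (I (s + u))^-1 + (I s)^-1)) => // u
    /andP[u0 ut].
    have ? := is_derive_addl (is_derive_gauss_slope (s01 _ u0 (le_trans ut td))).
    by apply: trigger_derive; rewrite /GRing.scale/=; ring.
  have ud := le_trans (ltW ut) td; have u0' := ltW u0.
  by rewrite addrC subr_ge0 lef_pV2 ?posrE ?Ile// gauss_iso_gt0 ?s01.
pose f (u : R) := I (s + u) - u + u ^+ 2 / (2 * I s).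
suff : f 0 <= f d by rewrite /f addr0; lra.
apply: (derive_ge0_le (df := fun u => - q (s + u) - 1 + u / I s)) => // u
  /andP[u0 ut].
  have ? := is_derive_addl (is_derive_gauss_iso (s01 _ u0 ut)).
  by apply: trigger_derive; rewrite /GRing.scale/=; field; rewrite gt_eqF.
by apply: slope; rewrite ltW.
Qed.

Lemma threshold_gt0 : 0 < T.
Proof. by rewrite /threshold; lra. Qed.

Lemma sqr_tau : tau ^+ 2 = 21 / 200.
Proof. by rewrite sqr_sqrtr /threshold; lra. Qed.

Lemma tau_bounds : 8 / 25 <= tau <= 33 / 100.
Proof.
apply/andP; split.
  by rewrite -(ler_sqr (R:=R)) ?nnegrE ?sqrtr_ge0// ?sqr_tau; lra.
by rewrite -(ler_sqr (R:=R)) ?nnegrE ?sqrtr_ge0// ?sqr_tau; lra.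
Qed.

(** At the root [phi / Phi] equals [tau / T], about 1.543, while at -1 it is below 43/28, about
    1.536; a decreasing ratio places the root left of -1. *)
Lemma gauss_ratio_root_le (x : R) : T * phi x = tau * Phi x -> x <= - 1.
Proof.
move=> e; rewrite leNgt; apply/negP => x1.
have h := gauss_ratio_decr x1; have N := @gauss_cdfN1_gt R.
have /andP[t1 t2] := tau_bounds; have t3 := sqr_tau.
have P0 := gauss_cdf_gt0 x.
have T0 := threshold_gt0.
have : Phi (- 1) * tau * Phi x < T * phi 1 * Phi x.
  rewrite -(gauss_pdfN 1).
  have : T * (Phi (- 1) * phi x) < T * (Phi x * phi (- 1)) by rewrite ltr_pM2l.
  by rewrite mulrCA e; lra.
rewrite ltr_pM2r// => h2.
have p0 := gauss_pdf_gt0 (1 : R).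
have : 28 / 43 * phi 1 * tau < T * phi 1.
  by apply: lt_trans h2; rewrite ltr_pM2r//; lra.
(* What remains would force [tau < 0.3225], whose square is below 21/200. *)
rewrite mulrAC ltr_pM2r// /threshold.
nra.
Qed.

(** The substitution [x = q (T / w)], that is [w = T / Phi x], turns the equation for [w] into one
    for [phi / Phi]. The case [w = T] is excluded since [I 1 = 0] and [tau > 0]. *)
Lemma scaled_iso_root (w : R) : T <= w -> gauss_iso_scaled w T = tau ->
  [/\ 0 < T / w < 1, T * phi (q (T / w)) = tau * Phi (q (T / w)) & q (T / w) <= - 1].
Proof.
have T0 := threshold_gt0; move=> Tw e; have w0 : 0 < w by exact: lt_le_trans Tw.
have /andP[t1 _] := tau_bounds.
have s01 : 0 < T / w < 1.
  rewrite divr_gt0//= lt_neqAle ler_pdivrMr// mul1r Tw andbT.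
  apply/eqP => s1; move: e t1.
  rewrite /gauss_iso_scaled s1 /gauss_iso ltxx andbF mulr0.
  lra.
have r : T * phi (q (T / w)) = tau * Phi (q (T / w)).
  by rewrite gauss_cdfK// -e /gauss_iso_scaled gauss_isoE//; field; rewrite gt_eqF.
by split=> //; exact: gauss_ratio_root_le.
Qed.

Lemma exists_unique_scale :
  exists! w : R, T <= w /\ gauss_iso_scaled w T = tau.
Proof.
have T0 := threshold_gt0; have /andP[t1 t2] := tau_bounds.
pose f (x : R) := T * phi x - tau * Phi x.
(* The signs at the ends come from the lower bound on Mills' ratio at 1 and the upper bound at 2,
   the latter with [tau <= 2 * T]. *)
have [x xr fx] : exists2 x, x \in `[-2, -1]%R & f x = 0.
  apply: IVT; first lra.
    apply: continuous_subspaceT => x.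
    apply: (@derive_continuous _ f (T * (- x * phi x) - tau * phi x)).
    have ? := is_derive_gauss_pdf x; have ? := is_derive_gauss_cdf x.
    by apply: trigger_derive.
  have f1 : f (- 1) <= 0.
    rewrite /f subr_le0 gauss_pdfN; have N := @gauss_cdfN1_gt R.
    have p0 := gauss_pdf_gt0 (1 : R); have := sqr_tau => t3.
    apply: (@le_trans _ _ (tau * (28 / 43 * phi 1))).
      by rewrite mulrA ler_pM2r// /threshold; nra.
    by rewrite ler_wpM2l ?sqrtr_ge0// ltW.
  have f2 : 0 <= f (- 2).
    have N := @gauss_cdfN_lt R 2 ltac:(lra); rewrite /f subr_ge0 gauss_pdfN.
    have P0 := gauss_cdf_gt0 (- 2 : R).
    apply: (@le_trans _ _ (T * (2 * Phi (- 2)))); last by rewrite ler_pM2l// ltW.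
    by rewrite mulrA ler_pM2r// /threshold; lra.
  by rewrite ge_min le_max f1 f2 orbT.
have P0 := gauss_cdf_gt0 x; have P1 := gauss_cdf_lt1 x.
exists (T / Phi x); split.
  split; first by rewrite ler_pdivlMr// ler_piMr ?ltW.
  rewrite /gauss_iso_scaled invf_div mulrCA divff ?gt_eqF// mulr1.
  rewrite gauss_isoE ?P0// gauss_quantileK mulrAC.
  rewrite -[RHS](mulfK (lt0r_neq0 P0)); congr (_ / _).
  by move: fx; rewrite /f; lra.
move=> w [Tw /(scaled_iso_root Tw)[s01 r _]].
have w0 : 0 < w by exact: lt_le_trans Tw.
suff -> : x = q (T / w).
  by rewrite gauss_cdfK// invf_div mulrCA divff ?gt_eqF// mulr1.
have {}fx : T * phi x = tau * Phi x by move: fx; rewrite /f; lra.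
have ne (y z : R) : T * phi y = tau * Phi y -> T * phi z = tau * Phi z -> ~ y < z.
  move=> ey ez /gauss_ratio_decr; rewrite -(ltr_pM2l T0).
  have -> : T * (Phi y * phi z) = T * (Phi z * phi y).
    by rewrite mulrCA ez [RHS]mulrCA ey; ring.
  by rewrite ltxx.
by have [xl|xl|//] := ltgtP x (q (T / w));
  [case: (ne _ _ fx r xl)|case: (ne _ _ r fx xl)].
Qed.

End profile.

(** * The two-point inequality for [chi] *)

Section chi.
Context {R : realType}.
Local Notation phi := (@gauss_pdf R).
Local Notation Phi := (@gauss_cdf R).
Local Notation q := (@gauss_quantile R).
Local Notation I := (@gauss_iso R).
Local Notation T := (threshold R).
Local Notation tau := (Num.sqrt (T / 2)).
Local Notation B := (T + Num.sqrt (T / 6)).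

Lemma gap_bounds : 0 <= Num.sqrt (T / 6) <= T.
Proof.
rewrite sqrtr_ge0/= -(ler_sqr (R:=R)) ?nnegrE ?sqrtr_ge0 ?ltW ?threshold_gt0//.
by rewrite sqr_sqrtr /threshold; lra.
Qed.

Variable w : R.
Hypotheses (Tw : T <= w) (wT : gauss_iso_scaled w T = tau).
Local Notation f := (gauss_iso_scaled w).

Let w0 : 0 < w. Proof. exact: lt_le_trans threshold_gt0 Tw. Qed.

Lemma gauss_iso_scaled_ge0 a : 0 <= f a.
Proof. by rewrite mulr_ge0 ?gauss_iso_ge0 ?(ltW w0). Qed.

(** Here [B <= 2 * T], and [T / w <= Phi (- 1)], which is at most half of [Phi 0]. So the whole
    range stays where the profile increases. *)
Lemma range_le_median a : a <= B -> a / w <= Phi 0.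
Proof.
move=> aB; have [s01 _ qs] := scaled_iso_root Tw wT.
have Tle : T / w <= Phi (- 1) by rewrite -[leLHS]gauss_cdfK// gauss_cdf_le.
have /andP[_ gT] := gap_bounds; have N := @gauss_cdfN1_le R.
apply: (@le_trans _ _ (2 * (T / w))); last lra.
by rewrite mulrA ler_pM2r ?invr_gt0//; lra.
Qed.

Lemma scaled_two_point (a h : R) : 0 <= h -> h <= a -> a <= T -> a + h <= B ->
  ((f (a + h) + f (a - h)) / 2) ^+ 2 + h ^+ 2 <= f a ^+ 2.
Proof.
move=> h0; have /andP[gap0 _] := gap_bounds.
have [->|an0] := eqVneq a 0 => ha aT ahB.
  have -> : h = 0 by lra.
  by rewrite addr0 subr0 (_ : (f 0 + f 0) / 2 = f 0) ?expr0n ?addr0//; field.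
have a0 : 0 < a by rewrite lt_neqAle eq_sym an0 (le_trans h0).
have ww := w0.
have [/andP[_ s1] _ qs] := scaled_iso_root Tw wT.
have aw : a / w <= T / w by rewrite ler_pM2r ?invr_gt0.
have := @gauss_two_point R (a / w) (h / w).
rewrite -mulrDl -mulrBl !divr_ge0 ?(ltW ww)// divr_gt0// ler_pM2r ?invr_gt0//.
have qa : q (a / w) <= - 1.
  move: aw; rewrite le_eqVlt => /predU1P[->//|aw].
  by apply: le_trans qs; apply/ltW/gauss_quantile_lt => //; rewrite divr_gt0.
move=> /(_ isT isT ha (range_le_median ahB) qa).
rewrite -(ler_pM2l (exprn_gt0 2 ww)) /gauss_iso_scaled !exprMn.
apply: le_trans; rewrite le_eqVlt; apply/orP; left; apply/eqP.
by field; rewrite gt_eqF.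
Qed.

(** With [d = b - T], the Taylor bound at [T] is [tau + d - d ^+ 2 / (2 * tau)], to be squared and
    compared with [b / 2 = tau ^+ 2 + d / 2]. *)
Lemma half_le_scaled (b : R) : T <= b -> b <= B -> b / 2 <= f b ^+ 2.
Proof.
move=> Tb bB; have ww := w0; have [s01 _ qs] := scaled_iso_root Tw wT.
have d0 : 0 <= b - T by lra.
have := @gauss_iso_ge R (T / w) ((b - T) / w) s01.
have -> : T / w + (b - T) / w = b / w by field; rewrite gt_eqF.
rewrite divr_ge0 ?(ltW ww)// => /(_ isT (range_le_median bB) qs).
have I0 : I (T / w) != 0 by rewrite gt_eqF// gauss_iso_gt0.
rewrite -(ler_pM2l ww) -/(f b).
have -> : w * (I (T / w) + (b - T) / w - ((b - T) / w) ^+ 2 / (2 * I (T / w))) =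
    tau + (b - T) - (b - T) ^+ 2 / (2 * tau).
  by rewrite -wT /gauss_iso_scaled; field; rewrite I0 gt_eqF.
have /andP[t1 t2] := @tau_bounds R; have tt := @sqr_tau R.
have {bB} : (b - T) ^+ 2 <= tau ^+ 2 / 3.
  have : b - T <= Num.sqrt (T / 6) by lra.
  have T6 : 0 <= T / 6 by rewrite /threshold; lra.
  rewrite -ler_sqr ?nnegrE ?sqrtr_ge0// tt sqr_sqrtr// /threshold; lra.
have bT : b = (b - T) + 2 * tau ^+ 2 by rewrite tt /threshold; lra.
move: bT d0; set d := b - T; set t := tau in t1 t2 tt * => bT d0 dt.
have t0 : 0 < t by lra.
have g0 : 0 <= t + d - d ^+ 2 / (2 * t).
  rewrite addrAC addr_ge0// subr_ge0 ler_pdivrMr ?mulr_gt0//; nra.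
move=> fb; apply: (@le_trans _ _ ((t + d - d ^+ 2 / (2 * t)) ^+ 2)); last first.
  by rewrite ler_sqr ?nnegrE ?gauss_iso_scaled_ge0.
have -> : (t + d - d ^+ 2 / (2 * t)) ^+ 2 =
    t ^+ 2 + 2 * t * d + (d ^+ 2 / (2 * t)) ^+ 2 - d * (d ^+ 2 / t).
  by field; rewrite gt_eqF.
(* Since [d ^+ 2 <= t ^+ 2 / 3], the cubic loss leaves at least [5 / 3 * t * d] of the linear term,
   which exceeds [d / 2] because [t >= 8 / 25]. *)
have dt3 : d * (d ^+ 2 / t) <= d * (t / 3).
  by rewrite ler_wpM2l// ler_pdivrMr//; lra.
have : 0 <= (d ^+ 2 / (2 * t)) ^+ 2 by rewrite sqr_ge0.
rewrite {1}bT; nra.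
Qed.

Lemma chi_ge0 a : 0 <= a -> 0 <= chi w a.
Proof. by move=> a0; rewrite /chi; case: ifP => _; rewrite ?sqr_ge0 ?divr_ge0. Qed.

Lemma sqrt_chi_le a : 0 <= a -> a <= B -> Num.sqrt (chi w a) <= f a.
Proof.
move=> a0 aB; rewrite /chi; case: ifPn => [_|]; rewrite -?ltNge.
  by rewrite sqrtr_sqr ger0_norm ?gauss_iso_scaled_ge0.
move=> /ltW Ta; rewrite -[leRHS]ger0_norm ?gauss_iso_scaled_ge0// -sqrtr_sqr.
by rewrite ler_wsqrtr// half_le_scaled.
Qed.

(** At the midpoint [chi] equals the squared profile, and at both end points its root is at most the
    profile, so the inequality for the profile transfers. *)
Lemma chi_two_point (a0 a1 : R) : 0 <= a0 <= B -> 0 <= a1 <= B ->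
  (a0 + a1) / 2 <= T ->
  1 / 4 * (Num.sqrt (chi w a0) + Num.sqrt (chi w a1)) ^+ 2
    + 1 / 4 * (a1 - a0) ^+ 2 <= chi w ((a0 + a1) / 2).
Proof.
wlog le01 : a0 a1 / a0 <= a1.
  move=> H; have [|/ltW] := leP a0 a1; first exact: H.
  move=> le10 h0 h1; rewrite addrC => h2; have := H _ _ le10 h1 h0 h2.
  have -> : (a0 - a1) ^+ 2 = (a1 - a0) ^+ 2 by ring.
  by rewrite [Num.sqrt _ + _]addrC.
move=> /andP[a00 a0B] /andP[a10 a1B] aT; rewrite {3}/chi aT.
have := @scaled_two_point ((a0 + a1) / 2) ((a1 - a0) / 2).
have -> : (a0 + a1) / 2 + (a1 - a0) / 2 = a1 by field.
have -> : (a0 + a1) / 2 - (a1 - a0) / 2 = a0 by field.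
rewrite divr_ge0 ?subr_ge0//= => /(_ isT _ aT a1B) W.
apply: le_trans (W _); last by lra.
have := sqrt_chi_le a00 a0B; have := sqrt_chi_le a10 a1B.
have := sqrtr_ge0 (chi w a0); have := sqrtr_ge0 (chi w a1).
set x := Num.sqrt (chi w a0); set y := Num.sqrt (chi w a1) => y0 x0 yf xf.
have : (x + y) ^+ 2 <= (f a1 + f a0) ^+ 2.
  by rewrite ler_sqr ?nnegrE ?addr_ge0 ?gauss_iso_scaled_ge0//; lra.
lra.
Qed.
End chi.

(** * Level-1 Fourier weights on the cube and its faces *)

Section cube.
Context {R : realType}.
Implicit Types n : nat.
Local Notation coord := Defs.coord.

(** Minkowski's inequality, with Cauchy-Schwarz obtained by expanding the sum of the squares
    [(y * u j - x * v j) ^+ 2]. *)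
Lemma sum_sqr_add (J : finType) (u v : J -> R) :
  \sum_j (u j + v j) ^+ 2 <=
  (Num.sqrt (\sum_j u j ^+ 2) + Num.sqrt (\sum_j v j ^+ 2)) ^+ 2.
Proof.
set U := \sum_j u j ^+ 2; set V := \sum_j v j ^+ 2; set S := \sum_j u j * v j.
have U0 : 0 <= U by apply: sumr_ge0 => j _; exact: sqr_ge0.
have V0 : 0 <= V by apply: sumr_ge0 => j _; exact: sqr_ge0.
have -> : \sum_j (u j + v j) ^+ 2 = U + V + 2 * S.
  rewrite mulr_sumr -!big_split/=; apply: eq_bigr => j _; ring.
set x := Num.sqrt U; set y := Num.sqrt V.
have xU : x ^+ 2 = U by rewrite sqr_sqrtr.
have yV : y ^+ 2 = V by rewrite sqr_sqrtr.
have x0 : 0 <= x by exact: sqrtr_ge0.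
have y0 : 0 <= y by exact: sqrtr_ge0.
suff : S <= x * y by rewrite -xU -yV; lra.
have h : 0 <= \sum_j (y * u j - x * v j) ^+ 2.
  by apply: sumr_ge0 => j _; exact: sqr_ge0.
have {}h : 0 <= (x * y) * (x * y - S).
  suff : \sum_j (y * u j - x * v j) ^+ 2 = 2 * ((x * y) * (x * y - S)) by lra.
  transitivity (y ^+ 2 * U + x ^+ 2 * V - 2 * (x * y) * S).
    rewrite !mulr_sumr -sumrN -!big_split/=; apply: eq_bigr => j _; ring.
  by rewrite -xU -yV; ring.
(* When [x * y = 0], one of the vectors vanishes, and so does [S]. *)
have [xy|] := ltP 0 (x * y); first by rewrite -subr_ge0 -(pmulr_rge0 _ xy).
move=> xy0; have : x * y = 0 by apply/eqP; rewrite eq_le xy0 mulr_ge0.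
move=> /[dup] xy /eqP; rewrite mulf_eq0 => /orP[]/eqP e; rewrite xy /S.
  have /eqP : U = 0 by rewrite -xU e expr0n.
  rewrite psumr_eq0; last by move=> j _; exact: sqr_ge0.
  move=> /allP u0; rewrite big1// => j _.
  by have := u0 j (mem_index_enum j); rewrite sqrf_eq0 => /eqP ->; rewrite mul0r.
have /eqP : V = 0 by rewrite -yV e expr0n.
rewrite psumr_eq0; last by move=> j _; exact: sqr_ge0.
move=> /allP u0; rewrite big1// => j _.
by have := u0 j (mem_index_enum j); rewrite sqrf_eq0 => /eqP ->; rewrite mulr0.
Qed.

(** The predicate lets one map serve both as the reflection in a single coordinate and as the
    antipodal map. *)
Definition cube_flip n (A : pred 'I_n) (x : cube n) : cube n :=
  [ffun j => A j (+) x j].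

Lemma cube_flipK n (A : pred 'I_n) : involutive (cube_flip A).
Proof. by move=> x; apply/ffunP => j; rewrite !ffunE addKb. Qed.

Lemma coord_cube_flip n (A : pred 'I_n) (x : cube n) j :
  coord R (cube_flip A x) j = (-1) ^+ A j * coord R x j.
Proof. by rewrite /coord ffunE signr_addb. Qed.

Lemma sum_coord_mul n (i j : 'I_n) :
  \sum_(x : cube n) coord R x i * coord R x j = (i == j)%:R * 2 ^+ n.
Proof.
have [->|ij] := eqVneq i j.
  rewrite mul1r (eq_bigr (fun=> 1)).
    by rewrite sumr_const card_ffun card_bool card_ord natrX.
  by move=> x _; rewrite /coord -expr2 sqrr_sign.
rewrite mul0r; set s := \sum_x _.
suff : s = - s by move=> ?; lra.
rewrite {1}/s (reindex_inj (inv_inj (cube_flipK (pred1 i)))) -sumrN.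
apply: eq_bigr => x _; rewrite !coord_cube_flip/= eqxx eq_sym (negbTE ij).
by rewrite expr1 expr0; ring.
Qed.

(** Let [l] be the linear part of [f]: both [E[f l]] and [E[l^2]] equal the weight [W]. Pointwise
    [f l <= f / 4 + P], where [P] is [l^2] restricted to [l > 0], and oddness of [l] gives
    [E P <= W / 2]. Hence [W <= E f / 4 + W / 2]. *)
Lemma weight1_le_half n (f : {ffun cube n -> bool}) :
  weight1 R f <= mean (fun x => (f x)%:R) / 2.
Proof.
have N0 : 0 < 2 ^+ n :> R by rewrite exprn_gt0.
pose l (x : cube n) : R := \sum_i fourier1 R f i * coord R x i.
have fl : \sum_x (f x)%:R * l x = 2 ^+ n * weight1 R f.
  under eq_bigr do rewrite mulr_sumr.
  rewrite exchange_big/= /weight1 mulr_sumr; apply: eq_bigr => i _.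
  under eq_bigr do rewrite mulrCA.
  rewrite -mulr_sumr expr2 mulrCA; congr (_ * _).
  by rewrite /fourier1 /mean mulrCA divff ?mulr1// gt_eqF.
have ll : \sum_x l x ^+ 2 = 2 ^+ n * weight1 R f.
  under eq_bigr do rewrite expr2 {1}/l mulr_suml.
  rewrite exchange_big/= /weight1 mulr_sumr; apply: eq_bigr => i _.
  under eq_bigr => x _.
    rewrite /l mulr_sumr.
    under eq_bigr do rewrite mulrACA.
    over.
  rewrite exchange_big/= (bigD1 i)//= [X in _ + X]big1 ?addr0.
    by rewrite -mulr_sumr sum_coord_mul eqxx mul1r expr2 mulrC.
  by move=> j ji; rewrite -mulr_sumr sum_coord_mul eq_sym (negbTE ji) mul0r mulr0.
pose P (x : cube n) : R := if 0 < l x then l x ^+ 2 else 0.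
have lN x : l (cube_flip predT x) = - l x.
  rewrite /l -sumrN; apply: eq_bigr => i _; rewrite coord_cube_flip/= expr1; ring.
(* Of two antipodal points at most one has [l] positive. *)
have PP : 2 * \sum_x P x <= \sum_x l x ^+ 2.
  rewrite mulr_natl mulr2n {2}(reindex_inj (inv_inj (cube_flipK predT))).
  rewrite -big_split/=.
  apply: ler_sum => x _; rewrite /P lN oppr_gt0 sqrrN.
  by case: ltgtP => _; rewrite ?addr0 ?add0r ?sqr_ge0.
have : \sum_x (f x)%:R * l x <= \sum_x ((f x)%:R / 4 + P x).
  apply: ler_sum => x _; rewrite /P.
  have : 0 <= (l x - 1 / 2) ^+ 2 by exact: sqr_ge0.
  by case: (f x); case: ltP => //=; nra.
rewrite big_split/= -mulr_suml /mean fl ll in PP * => h.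
rewrite mulrAC ler_pdivlMr//; lra.
Qed.

Definition cube_insert n (i : 'I_n.+1) (b : bool) (x : cube n) : cube n.+1 :=
  [ffun j => if unlift i j is Some k then x k else b].

Definition cube_face n (f : {ffun cube n.+1 -> bool}) (i : 'I_n.+1) (b : bool) :
  {ffun cube n -> bool} := [ffun x => f (cube_insert i b x)].

Lemma mean_cube_insert n (i : 'I_n.+1) (g : cube n.+1 -> R) :
  mean g = (mean (g \o cube_insert i false) + mean (g \o cube_insert i true)) / 2.
Proof.
pose h (p : bool * cube n) := cube_insert i p.1 p.2.
have hb : bijective h.
  exists (fun y : cube n.+1 => (y i, [ffun k => y (lift i k)])).
    move=> [b x]; rewrite /h /cube_insert/= ffunE unlift_none; congr pair.
    by apply/ffunP => k; rewrite !ffunE liftK.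
  move=> y; apply/ffunP => j; rewrite !ffunE/=.
  by case: unliftP => [k|] ->; rewrite ?ffunE.
rewrite /mean (reindex h)/=; last exact: onW_bij.
rewrite -(pair_bigA _ (fun b x => g (cube_insert i b x)))/= big_bool/= exprS.
have : 2 ^+ n != 0 :> R by rewrite expf_neq0.
by move=> ?; field.
Qed.

Lemma fourier1_cube_face_self n (f : {ffun cube n.+1 -> bool}) (i : 'I_n.+1) :
  fourier1 R f i = (mean (fun x => (cube_face f i false x)%:R)
    - mean (fun x => (cube_face f i true x)%:R)) / 2.
Proof.
rewrite /fourier1 (mean_cube_insert i); congr (_ / _); rewrite /mean -mulNr -sumrN.
congr (_ / _ + _ / _); apply: eq_bigr => x _;
  by rewrite /= /coord !ffunE unlift_none ?expr0 ?mulr1 ?expr1 ?mulrN1.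
Qed.

Lemma fourier1_cube_face_lift n (f : {ffun cube n.+1 -> bool}) (i : 'I_n.+1) k :
  fourier1 R f (lift i k) =
  (fourier1 R (cube_face f i false) k + fourier1 R (cube_face f i true) k) / 2.
Proof.
rewrite /fourier1 (mean_cube_insert i); congr ((_ + _) / _);
  by apply: congr1; apply/funext => x; rewrite /= /coord !ffunE liftK.
Qed.

(** Coefficients other than [i] are averages over the two faces, so Minkowski applies to them;
    coefficient [i] is set apart because it is half the difference of the face means. *)
Lemma weight1_cube_face n (f : {ffun cube n.+1 -> bool}) (i : 'I_n.+1) :
  weight1 R f <= 1 / 4 * (Num.sqrt (weight1 R (cube_face f i false))
      + Num.sqrt (weight1 R (cube_face f i true))) ^+ 2 + fourier1 R f i ^+ 2.
Proof.
rewrite [weight1 R f]/weight1 (bigD1_ord i)//= addrC lerD2r.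
under eq_bigr do rewrite fourier1_cube_face_lift expr_div_n.
rewrite -mulr_suml mulrC (_ : (2 ^+ 2)^-1 = 1 / 4 :> R); last by field.
by rewrite ler_pM2l; [exact: sum_sqr_add|lra].
Qed.

Lemma mean_ge0 n (g : cube n -> R) : (forall x, 0 <= g x) -> 0 <= mean g.
Proof. by move=> g0; rewrite divr_ge0 ?exprn_ge0// sumr_ge0. Qed.

Lemma small_fourier1 n (f : {ffun cube n.+1 -> bool}) :
  exists i, n.+1%:R * fourier1 R f i ^+ 2 <= weight1 R f.
Proof.
apply: contrapT => /forallNP H.
have : \sum_(i < n.+1) weight1 R f < \sum_(i < n.+1) n.+1%:R * fourier1 R f i ^+ 2.
  apply: ltr_sum => [|i _].
    by apply/hasP; exists ord0; rewrite ?mem_index_enum.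
  by rewrite ltNge; apply/negP; exact: H.
by rewrite sumr_const card_ord -mulr_sumr mulr_natl ltxx.
Qed.

(** The mean is a multiple of [2 ^- n], which is at least 1/4 here. *)
Lemma mean_lt_quarter n (f : {ffun cube n -> bool}) : (n <= 2)%N ->
  mean (fun x => (f x)%:R) < 1 / 4 :> R -> mean (fun x => (f x)%:R) = 0 :> R.
Proof.
move=> n2; rewrite /mean -natr_sum; set k := (\sum_x _)%N.
rewrite ltr_pdivrMr ?exprn_gt0// => kn.
have n4 : 2 ^+ n <= 4 :> R by rewrite -natrX ler_nat (@leq_pexp2l 2 n 2).
have : (k%:R : R) < 1%:R by lra.
by rewrite ltr_nat ltnS leqn0 => /eqP ->; rewrite mul0r.
Qed.

End cube.

(** * Induction on the dimension *)

Section level1.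
Context {R : realType}.
Local Notation T := (threshold R).

Lemma weight1_le_chi (w : R) n (f : {ffun cube n -> bool}) :
  T <= w -> gauss_iso_scaled w T = Num.sqrt (T / 2) ->
  mean (fun x => (f x)%:R) <= 1 / 2 :> R ->
  weight1 R f <= chi w (mean (fun x => (f x)%:R)).
Proof.
move=> Tw wT; elim: n f => [|n IHn] f f2; have W2 := @weight1_le_half R _ f;
  set a := mean _ in f2 W2 *; have a0 : 0 <= a by exact: mean_ge0.
  have [aT|aT] := leP a T; last by rewrite /chi ifN -?ltNge.
  have -> : weight1 R f = 0 by rewrite /weight1 big_ord0.
  exact: chi_ge0.
have [aT|aT] := leP a T; last by rewrite /chi ifN -?ltNge.
have T4 : T < 1 / 4 by rewrite /threshold; lra.
have [n2|n2] := leqP n.+1 2.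
  have az : a = 0 by apply: mean_lt_quarter => //; exact: le_lt_trans T4.
  by apply: le_trans (chi_ge0 w a0); rewrite (le_trans W2)// az mul0r.
have [i ci] := @small_fourier1 R _ f.
pose m b : R := mean (fun x => (cube_face f i b x)%:R).
have m0 b : 0 <= m b by exact: mean_ge0.
have am : a = (m false + m true) / 2.
  rewrite /a (mean_cube_insert i) /m; congr ((_ + _) / _);
    by apply: congr1; apply/funext => x; rewrite /= ffunE.
have cm : fourier1 R f i = (m false - m true) / 2 by exact: fourier1_cube_face_self.
(* In dimension at least 3 the chosen squared coefficient is at most a third of the weight, hence at
   most [a / 6 <= T / 6]. *)
have gap : `|(m false - m true) / 2| <= Num.sqrt (T / 6).
  rewrite -sqrtr_sqr -cm ler_wsqrtr//.
  have : 3 <= n.+1%:R :> R by rewrite ler_nat.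
  have : 0 <= fourier1 R f i ^+ 2 by exact: sqr_ge0.
  nra.
have /andP[_ gT] := @gap_bounds R.
have mB b : 0 <= m b <= T + Num.sqrt (T / 6).
  by rewrite m0/=; move: gap; rewrite ler_norml => /andP[]; case: b; lra.
(* The induction hypothesis asks for a face mean of at most 1/2; it is at most [2 * T]. *)
have mW b : weight1 R (cube_face f i b) <= chi w (m b).
  by apply: IHn; have /andP[_] := mB b; rewrite -/(m b); lra.
have := @chi_two_point R w Tw wT (m true) (m false) (mB true) (mB false).
rewrite [m true + _]addrC -am => /(_ aT); apply: le_trans.
apply: (le_trans (weight1_cube_face f i)); rewrite cm expr_div_n.
rewrite [Num.sqrt (chi _ _) + _]addrC.
apply: lerD; last lra.
rewrite ler_pM2l; last lra.
by rewrite ler_sqr ?nnegrE ?addr_ge0 ?sqrtr_ge0// lerD// ler_wsqrtr.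
Qed.

End level1.

Unset Implicit Arguments.

Theorem theorem4 (R : realType) :
  let T := threshold R in
  (exists! w : R, T <= w /\ gauss_iso_scaled w T = Num.sqrt (T / 2)) /\
  forall w : R, T <= w -> gauss_iso_scaled w T = Num.sqrt (T / 2) ->
  (forall a0 a1 : R,
     0 <= a0 <= T + Num.sqrt (T / 6) ->
     0 <= a1 <= T + Num.sqrt (T / 6) ->
     (a0 + a1) / 2 <= T ->
     Num.min
       (1 / 4 * (Num.sqrt (chi w a0) + Num.sqrt (chi w a1)) ^+ 2
        + 1 / 4 * (a1 - a0) ^+ 2)
       (varphi ((a0 + a1) / 2))
     - chi w ((a0 + a1) / 2) <= 0) /\
  (forall a : R, dyadic a -> 0 <= a <= 1 / 2 ->
     (Wsup a <= (chi w a)%:E)%E).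
Proof.
move=> T; split; first exact: exists_unique_scale.
move=> w Tw wT; split.
  move=> a0 a1 a0B a1B aT; rewrite subr_le0 ge_min.
  by rewrite (chi_two_point Tw wT a0B a1B aT).
move=> a _ /andP[a0 a1]; apply: ge_ereal_sup => _ [n _ <-].
(* The default value 0 of the maximum has to be bounded too, whence the nonnegativity of [chi]. *)
rewrite lee_fin; apply: bigmax_le; first exact: chi_ge0.
by move=> f /eqP fa; rewrite -fa; apply: weight1_le_chi => //; rewrite fa.
Qed.
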